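(* Let $n\in\mathbb{N}$, $n\ge1$, and let $p,q\in[1,\infty]$ with $p^{-1}+q^{-1}=1$. If $K\in L_q$, then $$\mathcal{E}^+\left(K*\Phi_p,\widetilde{SVH}^{T}_{2n-1}\right)_{L_\infty^A}\le 2\,E\left(K,H^{T}_{2n-1}\right)_{L_q}.$$
   Context: Scalar notation. $L_p$ ($1\le p\le\infty$) is the space of $2\pi$-periodic functions $f:\mathbb{R}\to\mathbb{R}$ with the usual norm $\|f\|_{L_p}=\left(\int_0^{2\pi}|f(x)|^p\,dx\right)^{1/p}$ (essential supremum for $p=\infty$). $H^T_{2n-1}$ is the $(2n-1)$-dimensional space of real trigonometric polynomials of order at most $n-1$, i.e. of functions $\frac{a_0}{2}+\sum_{k=1}^{n-1}(a_k\cos kx+b_k\sin kx)$, $a_k,b_k\in\mathbb{R}$. For $f\in L_q$, $E(f,H^T_{2n-1})_{L_q}=\inf_{T\in H^T_{2n-1}}\|f-T\|_{L_q}$. Set-valued notation. Fix $m\ge1$. $K(\mathbb{R}^m)$ is the set of nonempty compact subsets of $\mathbb{R}^m$, with the Hausdorff metric $\delta$ induced by the Euclidean norm $|\cdot|$; $\theta$ is the zero vector of $\mathbb{R}^m$ and $\|A\|=\delta(A,\{\theta\})$ for $A\in K(\mathbb{R}^m)$. For $\lambda\in\mathbb{R}$, $\lambda A=\{\lambda a:a\in A\}$, and $A+B=\{a+b:a\in A,b\in B\}$. For set-valued $f:[0,2\pi]\to K(\mathbb{R}^m)$ the integral is the Aumann integral $\int_0^{2\pi}f(x)\,dx=\left\{\int_0^{2\pi}\phi(x)\,dx:\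 \phi(x)\in f(x)\text{ a.e.},\ \phi\text{ integrable}\right\}$. $L_1^A$ is the set of measurable $2\pi$-periodic functions $f:\mathbb{R}\to K(\mathbb{R}^m)$ with $\|f(\cdot)\|$ integrable on $[0,2\pi]$; for $1\le p\le\infty$, $L_p^A=\{f\in L_1^A:\|f(\cdot)\|\in L_p\}$, with metric $\delta_{L_p^A}(f,g)=\|\delta(f(\cdot),g(\cdot))\|_{L_p}$. Put $\Phi_p=\{f\in L_p^A:\delta_{L_p^A}(f,\{\theta\})\le1\}$, where $\{\theta\}$ denotes the constant function. For $K\in L_q$ and $g\in L_p^A$, $K*g(x)=\int_0^{2\pi}K(x-t)g(t)\,dt$ (Aumann integral), and $K*\Phi_p=\{K*g:g\in\Phi_p\}$. $SVH^T_{2n-1}$ is the set of all set-valued functions $\tau(x)=\int_0^{2\pi}T(x-t)h(t)\,dt$ with $T\in H^T_{2n-1}$ and $h\in L_1^A$. $\widetilde{SVH}^T_{2n-1}$ is the set of all set-valued functions $\tilde\tau(x)=\tau(x)+B_r(\theta)$ with $\tau\in SVH^T_{2n-1}$, $r\ge0$, where $B_r(\theta)=\{z\in\mathbb{R}^m:|z|\le r\}$. The best one-sided approximation is $$\mathcal{E}^+(K*\Phi_p,\widetilde{SVH}^T_{2n-1})_{L^A_\infty}=\sup_{f\in K*\Phi_p}\ \inf\left\{\delta_{L^A_\infty}(f,\tilde\tau):\ \tilde\tau\in\widetilde{SVH}^T_{2n-1},\ f(x)\subset\tilde\tau(x)\text{ for all }x\in\mathbb{R}\right\}.$$ *)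

(* Defs.v *)
From HB Require Import structures.
From mathcomp Require Import all_boot all_order all_algebra.
From mathcomp Require Import all_classical all_reals all_analysis.

Set Implicit Arguments.
Unset Strict Implicit.
Unset Printing Implicit Defensive.

Import Order.TTheory GRing.Theory Num.Theory.
Import numFieldNormedType.Exports.

Local Open Scope classical_set_scope.
Local Open Scope ring_scope.

(* [R] equipped with the sigma-algebra of Lebesgue (not just Borel) measurable
   sets; as a type it is convertible to [R]. *)
Definition lebesgueType (R : realType) : measurableType _ :=
  caratheodory_type ((@wlength R idfun)^*)%mu.

Definition lebmu (R : realType) : {measure set (lebesgueType R) -> \bar R} :=
  @completed_lebesgue_measure R.

Definition itv2pi (R : realType) : set (lebesgueType R) := `[0, 2 * pi]%classic.
Arguments itv2pi R : clear implicits.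

Definition per2pi (R : realType) (T : Type) (f : R -> T) : Prop :=
  forall x, f (x + 2 * pi) = f x.

(* The norm of L_p over one period.  Restricting by 0 outside [0, 2 pi] changes
   neither the integral of |f|^p, 1 <= p < oo, nor the essential supremum of
   |f|. *)
Definition normL (R : realType) (p : \bar R) (f : R -> \bar R) : \bar R :=
  Lnorm (lebmu R) p ((f : lebesgueType R -> \bar R) \_ (itv2pi R)).

Definition Lspace2pi (R : realType) (p : \bar R) : set (R -> R) :=
  [set f | [/\ measurable_fun [set: lebesgueType R] (f : lebesgueType R -> R),
               per2pi f & (normL p (fun x => (f x)%:E) < +oo)%E]].

Definition trigpoly (R : realType) (n : nat) : set (R -> R) :=
  [set T | exists (a0 : R) (a b : nat -> R), forall x,
     T x = a0 / 2 +
       \sum_(1 <= k < n) (a k * cos (k%:R * x) + b k * sin (k%:R * x))].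

Definition best_approx (R : realType) (q : \bar R) (f : R -> R)
    (H : set (R -> R)) : \bar R :=
  ereal_inf [set normL q (fun x => (f x - T x)%:E) | T in H].

(* The norm MathComp-Analysis puts on ['rV_m] is the sup norm. *)
Definition enorm (R : realType) (m : nat) (v : 'rV[R]_m) : R :=
  Num.sqrt (\sum_(i < m) v 0 i ^+ 2).

(* Total on all sets, with extended values; it is the usual (finite) Hausdorff
   distance on nonempty compact sets. *)
Definition hdist (R : realType) (m : nat) (A B : set 'rV[R]_m) : \bar R :=
  maxe (ereal_sup [set ereal_inf [set (enorm (a - b))%:E | b in B] | a in A])
       (ereal_sup [set ereal_inf [set (enorm (a - b))%:E | a in A] | b in B]).

Definition setnorm (R : realType) (m : nat) (A : set 'rV[R]_m) : \bar R :=
  hdist A [set 0].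

Definition scaleset (R : realType) (m : nat) (c : R) (A : set 'rV[R]_m) :
    set 'rV[R]_m :=
  [set c *: a | a in A].

Definition addset (R : realType) (m : nat) (A B : set 'rV[R]_m) :
    set 'rV[R]_m :=
  [set a + b | a in A & b in B].

Definition eball (R : realType) (m : nat) (r : R) : set 'rV[R]_m :=
  [set z | enorm z <= r].

Definition vintegrable (R : realType) (m : nat) (phi : R -> 'rV[R]_m) : Prop :=
  forall i : 'I_m, (lebmu R).-integrable (itv2pi R)
    ((fun x => (phi x 0 i)%:E) : lebesgueType R -> \bar R).

Definition vintegral (R : realType) (m : nat) (phi : R -> 'rV[R]_m) :
    'rV[R]_m :=
  \row_(i < m) Rintegral (lebmu R) (itv2pi R)
    ((fun x => phi x 0 i) : lebesgueType R -> R).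

Definition aumann (R : realType) (m : nat) (f : R -> set 'rV[R]_m) :
    set 'rV[R]_m :=
  [set vintegral phi | phi in
    [set phi | vintegrable phi /\
       {ae lebmu R, forall x, itv2pi R x -> f x (phi x)}]].

(* Measurability of a compact-valued map: the inverse image
   {x | f x meets U} of every open set U is (Lebesgue) measurable. *)
Definition sv_measurable (R : realType) (m : nat) (f : R -> set 'rV[R]_m) :
    Prop :=
  forall U : set 'rV[R]_m, open U ->
    measurable ([set x | f x `&` U !=set0] : set (lebesgueType R)).

Definition L1A (R : realType) (m : nat) : set (R -> set 'rV[R]_m) :=
  [set f | [/\ forall x, f x !=set0 /\ compact (f x),
               sv_measurable f,
               per2pi f &
               (lebmu R).-integrable (itv2pi R)
                 ((fun x => setnorm (f x)) : lebesgueType R -> \bar R)]].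

Definition LA (R : realType) (m : nat) (p : \bar R) :
    set (R -> set 'rV[R]_m) :=
  [set f | L1A f /\ (normL p (fun x => setnorm (f x)) < +oo)%E].

Definition distLA (R : realType) (m : nat) (p : \bar R)
    (f g : R -> set 'rV[R]_m) : \bar R :=
  normL p (fun x => hdist (f x) (g x)).

Definition Phi (R : realType) (m : nat) (p : \bar R) :
    set (R -> set 'rV[R]_m) :=
  [set f | LA p f /\ (distLA p f (fun=> [set 0%R]) <= 1)%E].

Definition sv_conv (R : realType) (m : nat) (K : R -> R)
    (g : R -> set 'rV[R]_m) : R -> set 'rV[R]_m :=
  fun x => aumann (fun t => scaleset (K (x - t)) (g t)).

Definition SVH (R : realType) (m n : nat) : set (R -> set 'rV[R]_m) :=
  [set tau | exists2 T, trigpoly n T &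
             exists2 h, L1A h & tau = sv_conv T h].

Definition SVHtilde (R : realType) (m n : nat) : set (R -> set 'rV[R]_m) :=
  [set tau' | exists2 tau, SVH n tau &
              exists2 r : R, 0 <= r &
                tau' = (fun x => addset (tau x) (eball r))].

Definition one_sided (R : realType) (m : nat) (p : \bar R)
    (F G : set (R -> set 'rV[R]_m)) : \bar R :=
  ereal_sup [set ereal_inf [set distLA p f tau | tau in
                              [set tau | G tau /\ forall x, f x `<=` tau x]]
            | f in F].

(* Main.v *)
From HB Require Import structures.
From mathcomp Require Import all_boot all_order all_algebra.
From mathcomp Require Import all_classical all_reals all_analysis.
From mathcomp Require Import measurable_realfun ess_sup_inf.
From mathcomp Require Import lra ring.
Require Import Defs.

Set Implicit Arguments.
Unset Strict Implicit.
Unset Printing Implicit Defensive.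
Import Order.TTheory GRing.Theory Num.Theory.
Import numFieldNormedType.Exports.
Local Open Scope classical_set_scope.
Local Open Scope ring_scope.

(** Fix a trigonometric polynomial [T] and let [r] be the [L_q] norm of
    [K - T]; only the case of a finite [r] matters.  The one-sided approximant
    of [K * g] is [T * g + B_r], and it suffices to show that for every [x] the
    two sets [K * g (x)] and [T * g (x)] lie within [r] of each other in both
    directions ([hdist_addset_eball]): then [T * g (x) + B_r] contains
    [K * g (x)], and each of its points is within [2 r] of [K * g (x)].

    Two Aumann integrals can be compared because they can be parametrized by
    the same objects: every point of [D * g (x)] is
    [\int D(x - t) gam(t) dt] for a measurable selection [gam] of [g]
    ([sv_convP], [sv_conv_selection]).  Where [D (x - t) != 0] the selection is
    recovered from the integrand by dividing; where [D (x - t) = 0] the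
    integrand carries no information, and a measurable selection of [g] is
    needed to fill the gap.  Exchanging [K] for [T] while keeping [gam] moves
    the point by [\int (K - T)(x - t) gam(t) dt], whose Euclidean norm is at most
    [\int |K - T|(x - t) ||g(t)|| dt] ([enorm_vintegral_le]), hence at most
    [r] by Hoelder's inequality, since [||g||] has [L_p] norm at most 1
    ([sv_conv_kernel_close]).

    Three facts support this: the [L_q] norm of a periodic function over a
    period is unchanged by [t |-> x - t], for Lebesgue rather than Borel
    measurable functions ([normL_reflect]); Hoelder's inequality for extended
    exponents ([hoelder_conjugate_exponents]); and the selection theorem for
    measurable compact-valued maps into ['rV_m] ([measurable_selection]),
    proved by taking lexicographic minima. *)

(** * Reflections and Lebesgue measurable sets *)

Section reflection.
Context {R : realType}.
Local Notation mu := (@lebesgue_measure R).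
Local Notation X := (lebesgueType R).

Lemma measurable_reflect (x : R) :
  measurable_fun [set: measurableTypeR R]
    (fun t : measurableTypeR R => x - t : measurableTypeR R).
Proof. exact: measurable_funB. Qed.

Lemma measurable_reflect_preimage (x : R) (A : set R) :
  @measurable _ (measurableTypeR R) A ->
  @measurable _ (measurableTypeR R) ((fun t => x - t) @^-1` A).
Proof.
by move=> mA; have := measurable_reflect x measurableT mA; rewrite setTI.
Qed.

Lemma lebesgue_measure_reflect (x : R) (A : set (measurableTypeR R)) :
  measurable A -> mu ((fun t => x - t) @^-1` A) = mu A.
Proof.
pose f (t : measurableTypeR R) : measurableTypeR R := x - t.
have mf : measurable_fun setT f by exact: measurable_reflect.
pose mfm := isMeasurableFun.Build _ _ _ _ f mf.
pose pf : {mfun measurableTypeR R >-> measurableTypeR R} := HB.pack f mfm.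
move=> mA; rewrite -[LHS]/(pushforward mu pf A).
apply/esym/lebesgue_measure_unique => //= _ [[a b]] _ <-.
rewrite /pushforward.
have -> : pf @^-1` `]a, b]%classic = `[x - b, x - a[%classic.
  by apply/seteqP; split => t /=; rewrite !in_itv/= /pf/= /f; lra.
rewrite !lebesgue_measure_itv/= !lte_fin.
have -> : (x - b < x - a) = (a < b) by apply/idP/idP; lra.
by case: ifP => // _; rewrite -!EFinB; congr EFin; lra.
Qed.

(** The outer measure is computed from half-open intervals, a family that
    reflections do not preserve, so invariance cannot be read off it.  This
    decomposition transfers it from Borel sets instead. *)
Lemma lebesgue_measurableP (A : set X) : measurable A <->
  exists B N : set R,
    [/\ @measurable _ (measurableTypeR R) B, mu.-negligible N & A = B `|` N].
Proof.
have -> : measurable A = completed_algebra_gen mu A.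
  by rewrite -g_sigma_completed_algebra_genE completed_caratheodory_measurable.
split; first by move=> [B mB [N nN <-]]; exists B, N.
by move=> [B [N [mB nN ->]]]; exists B => //; exists N.
Qed.

Lemma borel_lebesgue_measurable (A : set R) :
  @measurable _ (measurableTypeR R) A -> @measurable _ X A.
Proof. by move=> mA; exact: sub_caratheodory. Qed.

Lemma lebesgue_measurable_itv (i : interval R) : @measurable _ X [set` i].
Proof. by apply: borel_lebesgue_measurable; exact: measurable_itv. Qed.

Lemma lebmu_negligibleU (B N : set R) :
  @measurable _ (measurableTypeR R) B -> mu.-negligible N ->
  lebmu R (B `|` N) = mu B.
Proof.
move=> mB [M [mM M0 NM]].
apply/eqP; rewrite eq_le; apply/andP; split; last first.
  by apply: le_outer_measure; exact: subsetUl.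
apply: (@le_trans _ _ (mu (B `|` M))).
  by apply: le_outer_measure; exact: setUS.
apply: (le_trans (measureU2 mu mB mM)).
by rewrite -[leRHS]adde0 -M0.
Qed.

Lemma negligible_reflect (x : R) (N : set R) :
  mu.-negligible N -> mu.-negligible ((fun t => x - t) @^-1` N).
Proof.
move=> [M [mM M0 NM]]; exists ((fun t => x - t) @^-1` M); split.
- exact: measurable_reflect_preimage.
- by apply: (eq_trans (lebesgue_measure_reflect x mM)).
- by move=> t /NM.
Qed.

Lemma lebesgue_measurable_reflect (x : R) :
  measurable_fun [set: X] (fun t : X => x - t : X).
Proof.
move=> _ A /lebesgue_measurableP [B [N [mB nN ->]]].
rewrite setTI preimage_setU; apply/lebesgue_measurableP.
exists ((fun t => x - t) @^-1` B), ((fun t => x - t) @^-1` N).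
split => //; first exact: measurable_reflect_preimage.
exact: negligible_reflect.
Qed.

Lemma lebmu_reflect (x : R) (A : set X) :
  measurable A -> lebmu R ((fun t => x - t) @^-1` A) = lebmu R A.
Proof.
move=> /lebesgue_measurableP [B [N [mB nN ->]]]; rewrite preimage_setU.
rewrite !lebmu_negligibleU//; first exact: lebesgue_measure_reflect.
- exact: measurable_reflect_preimage.
- exact: negligible_reflect.
Qed.

Lemma ge0_integral_reflect (x : R) (D : set X) (F : X -> \bar R) :
  measurable D -> measurable_fun D F -> (forall t, 0 <= F t)%E ->
  (\int[lebmu R]_(t in (fun t => x - t)%R @^-1` D) F (x - t)%R
   = \int[lebmu R]_(t in D) F t)%E.
Proof.
move=> mD mF F0.
pose f (t : X) : X := x - t.
have mf : measurable_fun setT f by exact: lebesgue_measurable_reflect.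
rewrite -[LHS]/(\int[lebmu R]_(t in f @^-1` D) (F \o f) t)%E.
rewrite -(ge0_integral_pushforward mf)//.
apply: eq_measure_integral => A mA _; exact: lebmu_reflect.
Qed.

(** * Integrals and norms of periodic functions over a period *)

Lemma measurable_itv2pi : measurable (itv2pi R).
Proof. exact: lebesgue_measurable_itv. Qed.

(** Dropping the null set [{2 pi}] leaves two intervals, each mapped onto
    itself by a reflection. *)
Lemma ge0_integral_itv2pi_split (y : R) (F : X -> \bar R) :
  0 <= y < 2 * pi ->
  measurable_fun [set: X] F -> (forall t, 0 <= F t)%E ->
  (\int[lebmu R]_(t in itv2pi R) F t
   = \int[lebmu R]_(t in (`[0%R, y]%classic : set R)) F t
   + \int[lebmu R]_(t in (`]y, (2 * pi)%R[%classic : set R)) F t)%E.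
Proof.
move=> y2 mF F0; have mI := lebesgue_measurable_itv.
have m1 : @measurable _ X [set (2 * pi : R)].
  by apply: borel_lebesgue_measurable; exact: measurable_set1.
rewrite (ge0_negligible_integral m1)//; last 3 first.
- exact: mI.
- exact: measurable_funTS.
- exact: lebesgue_measure_set1.
have -> : itv2pi R `\` [set 2 * pi] =
    `[0, y]%classic `|` `]y, (2 * pi)%R[%classic.
  apply/seteqP; split => t; rewrite /itv2pi /= !in_itv/=.
    move=> [/andP[t0 t2] tn].
    have t2' : t < 2 * pi by rewrite lt_neqAle t2 andbT; apply/eqP.
    by case: (leP t y) => ty; [left|right]; lra.
  by case => tt; split; (lra || by move=> te; move: tt y2; rewrite te; lra).
rewrite ge0_integral_setU//.
  exact: measurable_funTS.
apply/disj_setPS => t [/=]; rewrite !in_itv/=; lra.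
Qed.

Lemma per2pi_int (T : Type) (F : R -> T) (k : int) x :
  per2pi F -> F (x + 2 * pi *~ k) = F x.
Proof.
move=> pF.
have H (n : nat) z : F (z + 2 * pi *+ n) = F z.
  by elim: n z => [|n IH] z; rewrite ?mulr0n ?addr0// mulrSr addrA pF IH.
case: k => n; first exact: H.
by rewrite NegzE mulrNz -[LHS](H n.+1) subrK.
Qed.

(** With [x = y] modulo [2 pi] and [0 <= y < 2 pi], the reflection
    [t |-> x - t] of the circle acts on a period as [t |-> y - t] on [[0, y]]
    and as [t |-> y + 2 pi - t] on []y, 2 pi[]. *)
Lemma ge0_integral_per2pi_reflect (x : R) (F : X -> \bar R) :
  measurable_fun [set: X] F -> (forall t, 0 <= F t)%E -> per2pi F ->
  (\int[lebmu R]_(t in itv2pi R) F (x - t)%R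
   = \int[lebmu R]_(t in itv2pi R) F t)%E.
Proof.
move=> mF F0 pF; have mI := lebesgue_measurable_itv.
have pi20 : 0 < 2 * pi :> R by rewrite mulr_gt0// pi_gt0.
pose k := Num.floor (x / (2 * pi)).
pose y := x - 2 * pi *~ k.
have y2 : 0 <= y < 2 * pi.
  have /andP[k1 k2] := floor_itv (x / (2 * pi)).
  rewrite /y -mulrzr subr_ge0 -ler_pdivlMl// mulrC k1/= ltrBlDl.
  by move: k2; rewrite ltr_pdivrMr// intrD mulrDl mul1r [_%:~R * _]mulrC.
have FE t : F (x - t)%R = F (y - t)%R.
  by rewrite -[RHS](per2pi_int k _ pF) /y addrAC subrK.
have FE2 t : F (x - t)%R = F (y + 2 * pi - t)%R.
  by rewrite FE -[LHS]pF addrAC.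
rewrite !(ge0_integral_itv2pi_split y2)//; last first.
  exact: (measurableT_comp mF (lebesgue_measurable_reflect x)).
congr (_ + _)%E.
- rewrite -(ge0_integral_reflect y (mI _) (measurable_funTS mF) F0).
  under eq_integral do rewrite FE.
  congr integral; apply/seteqP; split => t /=; rewrite !in_itv/=; lra.
- rewrite -(ge0_integral_reflect (y + 2 * pi) (mI _) (measurable_funTS mF) F0).
  under eq_integral do rewrite FE2.
  congr integral; apply/seteqP; split => t /=; rewrite !in_itv/=; lra.
Qed.

(** The integral identity applied to the indicator function of the exceptional
    set. *)
Lemma ae_per2pi_reflect (x : R) (P : set X) :
  measurable P -> per2pi (P : R -> Prop) ->
  (\forall t \ae lebmu R, itv2pi R t -> P t) ->
  (\forall t \ae lebmu R, itv2pi R t -> P (x - t)%R).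
Proof.
move=> mP pP [N [mN N0 PN]]; have mI := measurable_itv2pi.
pose A : set X := (fun t : X => x - t : X)%R @^-1` ~` P.
have mA : measurable A.
  rewrite -[X in measurable X]setTI; apply: lebesgue_measurable_reflect => //.
  exact: measurableC.
exists (A `&` itv2pi R); split; first exact: measurableI.
- rewrite -integral_indic//.
  have -> : (\int[lebmu R]_(t in itv2pi R) (\1_A t)%:E =
      \int[lebmu R]_(t in itv2pi R) (\1_(~` P) (x - t)%R)%:E)%E.
    by apply: eq_integral => t _; rewrite !indicE.
  rewrite (@ge0_integral_per2pi_reflect x (fun t => (\1_(~` P) t)%:E)).
  + rewrite integral_indic//; last exact: measurableC.
    apply/eqP; rewrite -measure_le0 -N0; apply: le_measure; rewrite ?inE//.
      by apply: measurableI => //; exact: measurableC.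
    by move=> t [Pt It]; apply: PN => /= H; exact/Pt/H.
  + by apply/measurable_EFinP; apply: measurable_indic; exact: measurableC.
  + by move=> t; rewrite lee_fin.
  + move=> t; rewrite !indicE; congr ((nat_of_bool _)%:R%:E).
    by apply/idP/idP; rewrite !inE /= pP.
- by move=> t /= /not_implyP[It nP].
Qed.

End reflection.

(** * Hoelder's inequality for extended exponents *)

Section hoelder_extended.
Context d {T : measurableType d} {R : realType}.
Variable mu : {measure set T -> \bar R}.
Local Open Scope ereal_scope.

Lemma ae_le_Lnormy (g : T -> \bar R) :
  \forall x \ae mu, `|g x| <= Lnorm mu +oo g.
Proof.
rewrite unlock; case: ifPn => [mu0|]; first exact: ess_sup_ge.
rewrite -leNgt => mu0.
have muT0 : mu setT = 0 by apply/eqP; rewrite eq_le mu0/=.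
by exists setT; split.
Qed.

Lemma hoelder_1y (f g : T -> R) :
  measurable_fun setT f -> measurable_fun setT g ->
  Lnorm mu 1 (EFin \o (f \* g)%R)
    <= Lnorm mu 1 (EFin \o f) * Lnorm mu +oo (EFin \o g).
Proof.
move=> mf mg; rewrite !Lnorm1.
have mfg : measurable_fun [set: T] (abse \o (EFin \o f)).
  by apply: measurableT_comp => //; exact/measurable_EFinP.
rewrite -ge0_integralZr//; last exact: Lnorm_ge0.
apply: ae_ge0_le_integral => //.
- apply: measurableT_comp => //; apply/measurable_EFinP.
  exact: measurable_funM.
- by move=> x _; rewrite mule_ge0 ?Lnorm_ge0.
- exact: emeasurable_funM.
- apply: filterS (ae_le_Lnormy (EFin \o g)) => x /= gx _.
  by rewrite normrM EFinM lee_pmul.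
Qed.

Lemma hoelder_conjugate_exponents (f g : T -> R) (p q : \bar R) :
  measurable_fun setT f -> measurable_fun setT g ->
  1 <= p -> 1 <= q -> p^-1 + q^-1 = 1 ->
  Lnorm mu 1 (EFin \o (f \* g)%R)
    <= Lnorm mu p (EFin \o f) * Lnorm mu q (EFin \o g).
Proof.
move=> mf mg.
case: p => [p| |]//; case: q => [q| |]//; rewrite ?lee_fin.
- move=> p1 q1; have p0 : (0 < p)%R by lra.
  have q0 : (0 < q)%R by lra.
  rewrite !inver !gt_eqF// -EFinD => -[pq].
  exact: hoelder.
- move=> p1 _; rewrite inver gt_eqF; last lra.
  rewrite invey adde0 => -[/(congr1 (@GRing.inv R))].
  by rewrite invrK invr1 => ->; exact: hoelder_1y.
- move=> _ q1; rewrite inver gt_eqF; last lra.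
  rewrite invey add0e => -[/(congr1 (@GRing.inv R))].
  rewrite invrK invr1 => ->.
  rewrite muleC; under eq_Lnorm do rewrite /= mulrC.
  exact: hoelder_1y.
- by move=> _ _; rewrite invey adde0 => -[] /esym/eqP; rewrite oner_eq0.
Qed.

End hoelder_extended.

Section periodic_norms.
Context {R : realType}.
Local Notation X := (lebesgueType R).
Local Open Scope ereal_scope.

Lemma normL_EFin (r : R) (F : R -> \bar R) : (r != 0)%R ->
  normL r%:E F = (\int[lebmu R]_(t in itv2pi R) (`|F t| `^ r)) `^ (r^-1).
Proof.
move=> r0; rewrite /normL unlock; congr (_ `^ _).
rewrite [RHS]integral_mkcond; apply: eq_integral => t _.
by rewrite /patch; case: ifPn => // _; rewrite abse0 poweR0r.
Qed.

Lemma normLy_le (F : R -> \bar R) (r : R) : (0 <= r)%R ->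
  (forall x, 0 <= F x) -> (forall x, F x <= r%:E) -> normL +oo F <= r%:E.
Proof.
move=> r0 F0 Fr; rewrite /normL unlock.
case: ifPn => _; last by rewrite lee_fin.
apply/ess_supP/aeW => x; rewrite /patch /=.
by case: ifPn => _; [rewrite gee0_abs|rewrite abse0 lee_fin].
Qed.

Lemma normL_reflect (q : \bar R) (x : R) (D : R -> R) : 1 <= q ->
  measurable_fun [set: X] (D : X -> R) -> per2pi D ->
  normL q (fun t => (D (x - t)%R)%:E) <= normL q (fun t => (D t)%:E).
Proof.
move=> q1 mD pD; case: q q1 => [r r1| |//].
- have r0 : (r != 0)%R.
    by move: r1; rewrite lee_fin => r1; rewrite gt_eqF// (lt_le_trans _ r1).
  rewrite (normL_EFin _ r0) (normL_EFin _ r0).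
  rewrite (@ge0_integral_per2pi_reflect _ x (fun t => `|(D t)%:E| `^ r)).
  + exact: lexx.
  + apply: (measurableT_comp (measurable_poweR _)).
    apply: (measurableT_comp (@abse_measurable R setT)).
    exact/measurable_EFinP.
  + by move=> t; exact: poweR_ge0.
  + by move=> t; rewrite pD.
- move=> _; set M := normL +oo (fun t => (D t)%:E).
  have M0 : 0 <= M by exact: Lnorm_ge0.
  rewrite {1}/normL unlock; case: ifPn => // _.
  apply/ess_supP.
  suff : \forall t \ae lebmu R,
      itv2pi R t -> [set t | `|(D t)%:E| <= M] (x - t)%R.
    apply: filterS => t H /=; rewrite /patch; case: ifPn => [/set_mem/H//|_].
    by rewrite abse0.
  apply: ae_per2pi_reflect.
  + rewrite -[X in measurable X]setTI.
    have mD' : measurable_fun [set: X] (fun t : X => `|(D t)%:E|).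
      apply: (measurableT_comp (@abse_measurable R setT)).
      exact/measurable_EFinP.
    exact: emeasurable_fun_infty_c.
  + by move=> t /=; rewrite pD.
  + have := ae_le_Lnormy (lebmu R) ((fun t => (D t)%:E) \_ (itv2pi R)).
    by apply: filterS => t H It; move: H; rewrite /patch mem_set.
Qed.

Lemma measurable_reflect_kernel (x : R) (D : R -> R) :
  measurable_fun [set: X] (D : X -> R) ->
  measurable_fun [set: X] ((fun t => D (x - t)%R) : X -> R).
Proof.
by move=> mD; exact: (measurableT_comp mD (lebesgue_measurable_reflect x)).
Qed.

Lemma le_integral_conv (p q : \bar R) (x : R) (D G : R -> R) :
  1 <= p -> 1 <= q -> p^-1 + q^-1 = 1 ->
  measurable_fun [set: X] (D : X -> R) -> per2pi D ->
  measurable_fun (itv2pi R) (G : X -> R) ->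
  \int[lebmu R]_(t in itv2pi R) `|(D (x - t) * G t)%:E|
    <= normL q (fun t => (D t)%:E) * normL p (fun t => (G t)%:E).
Proof.
move=> p1 q1 pq mD pD mG; have mI := @measurable_itv2pi R.
have mDx := measurable_reflect_kernel x mD.
pose f : X -> R := (fun t => D (x - t)%R) \_ (itv2pi R).
pose g : X -> R := G \_ (itv2pi R).
have mf : measurable_fun setT f.
  by apply/(measurable_restrictT _ mI); exact: measurable_funTS.
have mg : measurable_fun setT g by exact/(measurable_restrictT _ mI).
rewrite addeC in pq.
rewrite integral_mkcond.
have -> : (fun t => `|(D (x - t)%R * G t)%:E|) \_ (itv2pi R) =
    (fun t => `|(EFin \o (f \* g)%R) t|).
  apply/funext => t; rewrite /f /g /= /patch; case: ifPn => // _.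
  by rewrite mulr0 normr0.
rewrite -Lnorm1.
apply: (le_trans (hoelder_conjugate_exponents (lebmu R) mf mg q1 p1 pq)).
rewrite /f /g -!restrict_EFin; apply: lee_pmul.
- exact: Lnorm_ge0.
- exact: Lnorm_ge0.
- exact: normL_reflect.
- exact: lexx.
Qed.

End periodic_norms.

(** * Euclidean norm and Hausdorff distance *)

Section euclidean_norm.
Context {R : realType} {m : nat}.
Implicit Types a b v : 'rV[R]_m.

Lemma enorm_ge0 v : 0 <= enorm v. Proof. exact: sqrtr_ge0. Qed.

Lemma sqr_enorm v : enorm v ^+ 2 = \sum_(i < m) v 0 i ^+ 2.
Proof. by rewrite sqr_sqrtr// sumr_ge0// => i _; exact: sqr_ge0. Qed.

Lemma enorm_le v (r : R) :
  0 <= r -> \sum_(i < m) v 0 i ^+ 2 <= r ^+ 2 -> enorm v <= r.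
Proof.
by move=> r0 vr; rewrite -(ler_pXn2r (n := 2)) ?nnegrE ?enorm_ge0// sqr_enorm.
Qed.

Lemma enorm0 : enorm (0 : 'rV[R]_m) = 0.
Proof. by rewrite /enorm big1 ?sqrtr0// => i _; rewrite mxE expr0n. Qed.

Lemma enormN v : enorm (- v) = enorm v.
Proof.
by rewrite /enorm; congr Num.sqrt; apply: eq_bigr => i _; rewrite mxE sqrrN.
Qed.

Lemma enormZ (c : R) v : enorm (c *: v) = `|c| * enorm v.
Proof.
rewrite /enorm -sqrtr_sqr -sqrtrM ?sqr_ge0// mulr_sumr.
by congr Num.sqrt; apply: eq_bigr => i _; rewrite mxE exprMn.
Qed.

Lemma normr_coord_le_enorm v i : `|v 0 i| <= enorm v.
Proof.
rewrite -sqrtr_sqr ler_wsqrtr// (bigD1 i)//= lerDl.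
by apply: sumr_ge0 => j _; exact: sqr_ge0.
Qed.

Lemma enorm_eq0_coord v i : enorm v = 0 -> v 0 i = 0.
Proof.
by move=> v0; have := normr_coord_le_enorm v i; rewrite v0 normr_le0 => /eqP.
Qed.

Lemma dot_le_enorm a b : \sum_(i < m) a 0 i * b 0 i <= enorm a * enorm b.
Proof.
have [a0|a0] := eqVneq (enorm a) 0.
  by rewrite a0 mul0r big1// => i _; rewrite enorm_eq0_coord// mul0r.
have [b0|b0] := eqVneq (enorm b) 0.
  by rewrite b0 mulr0 big1// => i _; rewrite (enorm_eq0_coord _ b0) mulr0.
have ab0 : 0 < enorm a * enorm b by rewrite mulr_gt0// lt0r ?a0 ?b0 enorm_ge0.
(* Expanding | |b| a - |a| b |^2 >= 0 and dividing by 2 |a| |b|. *)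
have : 0 <= \sum_(i < m) (enorm b * a 0 i - enorm a * b 0 i) ^+ 2.
  by apply: sumr_ge0 => i _; exact: sqr_ge0.
have -> : \sum_(i < m) (enorm b * a 0 i - enorm a * b 0 i) ^+ 2 =
    enorm b ^+ 2 * (\sum_(i < m) a 0 i ^+ 2)
    - (2 * (enorm a * enorm b)) * (\sum_(i < m) a 0 i * b 0 i)
    + enorm a ^+ 2 * \sum_(i < m) b 0 i ^+ 2.
  by rewrite !mulr_sumr -sumrB -big_split/=; apply: eq_bigr => i _; ring.
rewrite -!sqr_enorm => H.
rewrite -(ler_pM2l ab0); nra.
Qed.

Lemma enormD a b : enorm (a + b) <= enorm a + enorm b.
Proof.
apply: enorm_le; first by rewrite addr_ge0// enorm_ge0.
have -> : \sum_(i < m) (a + b) 0 i ^+ 2 =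
    \sum_(i < m) a 0 i ^+ 2 + 2 * (\sum_(i < m) a 0 i * b 0 i)
    + \sum_(i < m) b 0 i ^+ 2.
  rewrite mulr_sumr -!big_split/=; apply: eq_bigr => i _.
  by rewrite mxE; ring.
by rewrite -!sqr_enorm; have := dot_le_enorm a b; nra.
Qed.

Lemma continuous_enorm : continuous (@enorm R m).
Proof.
have sumc : continuous (fun v : 'rV[R]_m => \sum_(i < m) v 0 i ^+ 2).
  apply: continuous_big => [|i _ v]; first exact: add_continuous.
  apply: (@continuous_comp _ _ _ (fun v : 'rV[R]_m => v 0 i)
           (fun y => y ^+ 2)); first exact: coord_continuous.
  exact: exprn_continuous.
move=> v; apply: (continuous_comp (sumc v)); exact: sqrt_continuous.
Qed.

Lemma hdist_ge0 (A B : set 'rV[R]_m) : A !=set0 -> (0 <= hdist A B)%E.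
Proof.
move=> [a Aa]; rewrite /hdist le_max; apply/orP; left.
apply: (le_trans _ (ereal_sup_ubound _)); last by exists a.
by apply: le_ereal_inf_tmp => _ [b _ <-]; rewrite lee_fin enorm_ge0.
Qed.

Lemma enorm_le_setnorm (A : set 'rV[R]_m) a :
  A a -> ((enorm a)%:E <= setnorm A)%E.
Proof.
move=> Aa; rewrite /setnorm /hdist le_max; apply/orP; left.
apply: (le_trans _ (ereal_sup_ubound _)); last by exists a.
by rewrite image_set1 ereal_inf1 subr0.
Qed.

Lemma setnorm_fin_num (A : set 'rV[R]_m) :
  A !=set0 -> compact A -> setnorm A \is a fin_num.
Proof.
move=> A0 cA.
have [c cAc cmax] :=
  compact_EVT_max A0 cA (continuous_subspaceT continuous_enorm).
have Ac : A c by rewrite inE in cAc.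
have cmax' b : A b -> enorm b <= enorm c by move=> Ab; apply: cmax; rewrite inE.
rewrite ge0_fin_numE; last exact: hdist_ge0.
apply: (@le_lt_trans _ _ (enorm c)%:E); last exact: ltry.
rewrite /setnorm /hdist ge_max; apply/andP.
split; apply: ge_ereal_sup => _ [b /= Ab <-].
  by rewrite image_set1 ereal_inf1 subr0 lee_fin cmax'.
by apply: ereal_inf_lbound; exists c => //; rewrite Ab subr0.
Qed.

(** The reason for the factor 2: enlarging [B] by [r] so that it covers [A]
    may push points that were already at distance [r] from [A] away by another
    [r]. *)
Lemma hdist_addset_eball (A B : set 'rV[R]_m) (r : R) : 0 <= r ->
  (forall a, A a -> exists2 b, B b & enorm (a - b) <= r) ->
  (forall b, B b -> exists2 a, A a & enorm (b - a) <= r) ->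
  A `<=` addset B (eball r) /\
  (hdist A (addset B (eball r)) <= (2 * r)%:E)%E.
Proof.
move=> r0 AB BA.
have sub : A `<=` addset B (eball r).
  move=> a Aa; have [b Bb ab] := AB a Aa.
  by exists b => //; exists (a - b) => //; rewrite addrC subrK.
split => //; rewrite /hdist ge_max; apply/andP.
split; apply: ge_ereal_sup => _ [a /= Aa <-].
  apply: (@le_trans _ _ (enorm (a - a))%:E).
    by apply: ereal_inf_lbound; exists a => //; exact: sub.
  by rewrite subrr enorm0 lee_fin mulr_ge0.
case: Aa => b Bb [z zr <-]; have [a' Aa' ba] := BA b Bb.
apply: (@le_trans _ _ (enorm (a' - (b + z)))%:E).
  by apply: ereal_inf_lbound; exists a'.
rewrite lee_fin -enormN opprB addrAC mulr_natl mulr2n.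
by apply: (le_trans (enormD _ _)); exact: lerD.
Qed.

End euclidean_norm.

(** * Measurable selections of compact-valued maps *)

Section measurable_selection.
Context d {T : measurableType d} {R : realType} {m : nat}.
Implicit Types F : T -> set 'rV[R]_m.

(** Unlike its analogue with open sets, this form of measurability passes
    directly to the subset of points minimizing a coordinate. *)
Definition closed_measurable F := forall C : set 'rV[R]_m, closed C ->
  measurable [set x | F x `&` C !=set0].

(** A compact set that misses the closed set [C] also misses an open
    neighborhood of [C] of radius [1 / (n + 1)] for some [n], so meeting [C]
    means meeting countably many open sets. *)
Lemma compact_closed_measurable F : (forall x, compact (F x)) ->
  (forall U : set 'rV[R]_m, open U -> measurable [set x | F x `&` U !=set0]) ->
  closed_measurable F.
Proof.
move=> cF mF C cC.
pose U (n : nat) := \bigcup_(c in C) (ball c (n.+1%:R^-1 : R))^°.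
have -> : [set x | F x `&` C !=set0] = \bigcap_n [set x | F x `&` U n !=set0].
  apply/seteqP; split => x /=.
    move=> [a [Fa Ca]] n _; exists a; split => //; exists a => //.
    exact: (nbhs_singleton (nbhs_interior (nbhsx_ballx a _ _))).
  move=> FU; apply: contrapT => FC.
  have covF := (compact_near_coveringP (F x)).1 (cF x).
  have : \forall n \near \oo, F x `<=` [set a | ~ U n a].
    apply: (covF _ _ (fun n a => ~ U n a)) => a Fa.
    have nCa : ~ C a by move=> Ca; apply: FC; exists a.
    have : nbhs a (~` C).
      by apply: open_nbhs_nbhs; split => //; exact: closed_openC.
    move=> /nbhs_ballP[e /= e0 aC].
    have e20 : 0 < e / 2 by rewrite divr_gt0.
    near=> b n.
    have ne : n.+1%:R^-1 < e / 2.
      by near: n; exact: near_infty_natSinv_lt (PosNum e20).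
    move=> -[c Cc /interior_subset cb].
    apply: (aC c) => //; rewrite [e]splitr.
    apply: (@ball_triangle _ _ b).
      by near: b; exact: nbhsx_ballx.
    apply/ball_sym; apply: le_ball cb; exact: ltW.
  move=> [n _ /(_ n (leqnn n)) FnU].
  by have [a [/FnU]] := FU n I.
apply: bigcapT_measurable => n; apply: mF.
by apply: bigcup_open => c _; exact: open_interior.
Unshelve. all: by end_near. Qed.

Definition argmin_coord F (i : 'I_m) : T -> set 'rV[R]_m := fun x =>
  [set a | F x a /\ forall b, F x b -> a 0 i <= b 0 i].

Lemma closed_coord_le (i : 'I_m) (c : R) :
  closed [set a : 'rV[R]_m | a 0 i <= c].
Proof.
apply: (@closed_comp _ _ (fun a : 'rV[R]_m => a 0 i) [set y | y <= c]).
  by move=> a _; exact: coord_continuous.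
exact: closed_le.
Qed.

Lemma closed_coord_ge (i : 'I_m) (c : R) :
  closed [set a : 'rV[R]_m | c <= a 0 i].
Proof.
apply: (@closed_comp _ _ (fun a : 'rV[R]_m => a 0 i) [set y | c <= y]).
  by move=> a _; exact: coord_continuous.
exact: closed_ge.
Qed.

Lemma argmin_coord_compact F i x : F x !=set0 -> compact (F x) ->
  argmin_coord F i x !=set0 /\ compact (argmin_coord F i x).
Proof.
move=> F0 cF; split.
  have [c cF' cmin] := compact_EVT_min F0 cF
    (continuous_subspaceT (@coord_continuous R 1 m 0 i)).
  exists c; split; first by rewrite inE in cF'.
  by move=> b Fb; apply: cmin; rewrite inE.
have -> : argmin_coord F i x =
    F x `&` \bigcap_(b in F x) [set a | a 0 i <= b 0 i].
  by apply/seteqP; split => a [Fa H].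
by apply: compact_closedI => //; apply: closed_bigI => b _;
  exact: closed_coord_le.
Qed.

(** The set of minimizers meets [C] exactly when the minimum over [F x]
    intersected with [C] is not larger than the minimum over [F x]; rational
    thresholds [c] detect this. *)
Lemma argmin_coord_measurable F i :
  (forall x, F x !=set0) -> (forall x, compact (F x)) ->
  closed_measurable F -> closed_measurable (argmin_coord F i).
Proof.
move=> F0 cF mF C cC.
pose H (c : R) := [set a : 'rV[R]_m | a 0 i <= c].
have -> : [set x | argmin_coord F i x `&` C !=set0] =
    [set x | F x `&` C !=set0] `\`
    \bigcup_(c : rat) ([set x | F x `&` H (ratr c) !=set0] `\`
                       [set x | F x `&` (C `&` H (ratr c)) !=set0]).
  apply/seteqP; split => x /=.
    move=> [a [[Fa amin] Ca]]; split; first by exists a.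
    move=> [c _ [[b [Fb Hb]]]]; apply; exists a; split => //; split => //.
    by apply: le_trans Hb; exact: amin.
  move=> [FC nmin].
  have cFC : compact (F x `&` C) by exact: compact_closedI.
  have [a aFC amin] := compact_EVT_min FC cFC
    (continuous_subspaceT (@coord_continuous R 1 m 0 i)).
  move: aFC; rewrite inE => -[Fa Ca].
  exists a; split => //; split => // b Fb; rewrite leNgt; apply/negP => ba.
  have [c] := rat_in_itvoo ba; rewrite in_itv/= => /andP[bc ca].
  apply: nmin; exists c => //; split.
    by exists b; split => //; exact: ltW.
  move=> [a' [Fa' [Ca' Ha']]].
  have : a 0 i <= a' 0 i by apply: amin; rewrite inE.
  by rewrite leNgt (le_lt_trans Ha' ca).
apply: measurableD; first exact: mF.
apply: bigcupT_measurable_rat => c; apply: measurableD; apply: mF.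
  exact: closed_coord_le.
by apply: closedI => //; exact: closed_coord_le.
Qed.

(** Minimizing the coordinates one after the other shrinks [F x] to its
    lexicographically least point, which therefore depends measurably on
    [x]. *)
Lemma measurable_selection F :
  (forall x, F x !=set0) -> (forall x, compact (F x)) ->
  closed_measurable F ->
  exists s : T -> 'rV[R]_m, (forall x, F x (s x)) /\
    forall i, measurable_fun setT (fun x => s x 0 i).
Proof.
move=> F0 cF mF.
have lexmin (s : seq 'I_m) : exists G : T -> set 'rV[R]_m,
    [/\ forall x, G x !=set0, forall x, compact (G x), closed_measurable G,
        forall x, G x `<=` F x &
        forall i, i \in s -> forall x a b, G x a -> G x b -> a 0 i = b 0 i].
  elim: s => [|i s [G [G0 cG mG GF Gone]]].
    by exists F; split => // x; exact: subset_refl.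
  exists (argmin_coord G i); split.
  - by move=> x; have [] := argmin_coord_compact i (G0 x) (cG x).
  - by move=> x; have [] := argmin_coord_compact i (G0 x) (cG x).
  - exact: argmin_coord_measurable.
  - by move=> x a [/GF].
  - move=> j; rewrite inE => /predU1P[->|js] x a b [Ga amin] [Gb bmin].
      by apply/eqP; rewrite eq_le amin// bmin.
    exact: Gone js _ _ _ Ga Gb.
have [G [G0 cG mG GF Gone]] := lexmin (enum 'I_m).
exists (fun x => projT1 (cid (G0 x))); split.
  by move=> x; apply: GF; case: cid.
move=> i; apply: (measurability _ (RGenCInfty.measurableE R)) => _ [_ [c ->]] <-.
rewrite setTI.
have -> : (fun x => projT1 (cid (G0 x)) 0 i) @^-1` `[c, +oo[%classic =
    [set x | G x `&` [set a | c <= a 0 i] !=set0].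
  apply/seteqP; split => x /=; rewrite in_itv/= andbT; case: cid => s Gs /=.
    by move=> cs; exists s.
  by move=> [a [Ga ca]]; rewrite (Gone i (mem_enum _ _) x s a).
by apply: mG; exact: closed_coord_ge.
Qed.

End measurable_selection.

(** * Integrals of vector-valued functions *)

Section vintegral_theory.
Context {R : realType} {m : nat}.
Local Notation X := (lebesgueType R).
Implicit Types phi psi : R -> 'rV[R]_m.

Lemma vintegrableB phi psi : vintegrable phi -> vintegrable psi ->
  vintegrable (fun t => phi t - psi t).
Proof.
move=> iphi ipsi i; have mI := @measurable_itv2pi R.
apply: eq_integrable (integrableB mI (iphi i) (ipsi i)); first exact: mI.
by move=> t _ /=; rewrite !mxE.
Qed.

Lemma vintegralB phi psi : vintegrable phi -> vintegrable psi ->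
  vintegral phi - vintegral psi = vintegral (fun t => phi t - psi t).
Proof.
move=> iphi ipsi; apply/rowP => i; rewrite !mxE.
rewrite -(RintegralB (@measurable_itv2pi R) (iphi i) (ipsi i)).
by apply: eq_Rintegral => t _; rewrite !mxE.
Qed.

(** For [v] the integral of [phi], the number [|v|^2] is the integral of the
    scalar product of [v] and [phi], which Cauchy-Schwarz bounds by [|v|] times
    the integral of [h]. *)
Lemma enorm_vintegral_le phi (h : R -> R) : vintegrable phi ->
  (lebmu R).-integrable (itv2pi R) ((fun t => (h t)%:E) : X -> \bar R) ->
  (forall t, itv2pi R t -> enorm (phi t) <= h t) ->
  enorm (vintegral phi) <= Rintegral (lebmu R) (itv2pi R) (h : X -> R).
Proof.
move=> iphi ih phih; set v := vintegral phi; set I := Rintegral _ _ _.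
have mI := @measurable_itv2pi R.
have I0 : 0 <= I.
  apply: Rintegral_ge0 => t It; apply: le_trans (phih t It).
  exact: enorm_ge0.
have iv i : (lebmu R).-integrable (itv2pi R)
    ((fun t => (v 0 i * phi t 0 i)%:E) : X -> \bar R).
  apply: eq_integrable (integrableZl mI (v 0 i) (iphi i)); first exact: mI.
  by move=> t _.
have vE : enorm v ^+ 2 = Rintegral (lebmu R) (itv2pi R)
    (fun t => \sum_(i < m) v 0 i * phi t 0 i).
  rewrite sqr_enorm /Rintegral.
  under [in RHS]eq_integral do rewrite -sumEFin.
  rewrite (integral_sum mI iv) -sum_fine; last first.
    by move=> i _; exact: integrable_fin_num.
  apply: eq_bigr => i _.
  by rewrite -/(Rintegral _ _ _) (RintegralZl _ mI (iphi i)) expr2 /v mxE.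
have isum : (lebmu R).-integrable (itv2pi R)
    ((fun t => (\sum_(i < m) v 0 i * phi t 0 i)%:E) : X -> \bar R).
  apply: eq_integrable (integrable_sum mI (index_enum _) (P := xpredT)
    (fun i _ => iv i)); first exact: mI.
  by move=> t _; rewrite /= sumEFin.
have : enorm v ^+ 2 <= enorm v * I.
  rewrite vE /I -(RintegralZl _ mI ih); apply: le_Rintegral => //.
    apply: eq_integrable (integrableZl mI (enorm v) ih); first exact: mI.
    by move=> t _.
  move=> t It; apply: (le_trans (dot_le_enorm _ _)).
  by rewrite ler_wpM2l ?enorm_ge0// phih.
have [->//|v0] := eqVneq (enorm v) 0.
by rewrite expr2 ler_pM2l// lt0r v0 enorm_ge0.
Qed.

End vintegral_theory.

(** * Set-valued convolutions through measurable selections *)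

Section sv_convolution.
Context {R : realType} {m : nat}.
Local Notation X := (lebesgueType R).
Implicit Types (D : R -> R) (g : R -> set 'rV[R]_m) (gam : R -> 'rV[R]_m).

Definition selection g gam : Prop :=
  (forall t, g t (gam t)) /\
  forall i, measurable_fun [set: X] ((fun t => gam t 0 i) : X -> R).

Lemma L1A_selection g : L1A g -> exists gam, selection g gam.
Proof.
move=> [g0c mg _ _].
have g0 t := (g0c t).1; have cg t := (g0c t).2.
have [gam [ggam mgam]] := @measurable_selection _ X R m g g0 cg
  (@compact_closed_measurable _ X R m g cg mg).
by exists gam.
Qed.

Definition gauge g (t : R) : R := fine (setnorm (g t)).

Lemma gaugeE g : L1A g -> forall t, (gauge g t)%:E = setnorm (g t).
Proof.
move=> [g0c _ _ _] t; have [g0 cg] := g0c t.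
by rewrite fineK// setnorm_fin_num.
Qed.

Lemma measurable_gauge g :
  L1A g -> measurable_fun (itv2pi R) (gauge g : X -> R).
Proof.
move=> gL; have [_ _ _ /measurable_int mg] := gL.
by apply/measurable_EFinP; apply: eq_measurable_fun mg => t _; rewrite /= gaugeE.
Qed.

Lemma enorm_selection_le g gam t :
  L1A g -> g t (gam t) -> enorm (gam t) <= gauge g t.
Proof. by move=> gL gt; rewrite -lee_fin gaugeE//; exact: enorm_le_setnorm. Qed.

(** The property of a kernel that makes its convolution with [g] at [x]
    behave well.  It is stable under subtraction, so a trigonometric polynomial
    [T] acquires it as the difference of [K] and [K - T]. *)
Definition conv_integrable g (x : R) D : Prop :=
  measurable_fun [set: X] (D : X -> R) /\
  (lebmu R).-integrable (itv2pi R)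
    ((fun t => (D (x - t) * gauge g t)%:E) : X -> \bar R).

Section Phi.
Variables (p q : \bar R) (g : R -> set 'rV[R]_m).
Hypotheses (p_ge1 : (1 <= p)%E) (q_ge1 : (1 <= q)%E).
Hypothesis (pq1 : (p^-1 + q^-1 = 1)%E).
Hypothesis (gPhi : Phi p g).

Lemma Phi_L1A : L1A g. Proof. by have [[]] := gPhi. Qed.

Lemma normL_gauge_le1 : (normL p (fun t => (gauge g t)%:E) <= 1)%E.
Proof.
have [_] := gPhi; congr (normL p _ <= 1)%E.
by apply/funext => t; rewrite (gaugeE Phi_L1A).
Qed.

Lemma integral_conv_gauge_le (x : R) D :
  measurable_fun [set: X] (D : X -> R) -> per2pi D ->
  (\int[lebmu R]_(t in itv2pi R) `|(D (x - t)%R * gauge g t)%:E|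
    <= normL q (fun t => (D t)%:E))%E.
Proof.
move=> mD pD; have mg := measurable_gauge Phi_L1A.
apply: (le_trans (le_integral_conv x p_ge1 q_ge1 pq1 mD pD mg)).
rewrite -[leRHS]mule1; apply: lee_wpmul2l; first exact: Lnorm_ge0.
exact: normL_gauge_le1.
Qed.

Lemma integrable_conv_gauge (x : R) D :
  Lspace2pi q D -> conv_integrable g x D.
Proof.
move=> [mD pD Dq]; split => //; apply/integrableP; split.
  apply/measurable_EFinP; apply: measurable_funM.
    by apply: measurable_funTS; exact: measurable_reflect_kernel.
  exact: measurable_gauge Phi_L1A.
by apply: le_lt_trans Dq; exact: integral_conv_gauge_le.
Qed.

End Phi.

Section kernels.
Variables (g : R -> set 'rV[R]_m) (x : R).
Hypothesis gL1A : L1A g.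

Lemma conv_integrableB D1 D2 : conv_integrable g x D1 ->
  conv_integrable g x D2 -> conv_integrable g x (fun t => D1 t - D2 t).
Proof.
move=> [mD1 iD1] [mD2 iD2]; split; first exact: measurable_funB.
have mI := @measurable_itv2pi R.
apply: eq_integrable (integrableB mI iD1 iD2); first exact: mI.
by move=> t _; rewrite /= -EFinB mulrBl.
Qed.

Lemma vintegrable_conv_selection D gam : conv_integrable g x D ->
  selection g gam -> vintegrable (fun t => D (x - t) *: gam t).
Proof.
move=> [mD iD] [ggam mgam] i; have mI := @measurable_itv2pi R.
apply: (le_integrable mI _ _ iD).
  apply/measurable_EFinP.
  apply: (eq_measurable_fun (fun t : X => D (x - t) * gam t 0 i)).
    by move=> t _; rewrite mxE.
  apply: measurable_funTS; apply: measurable_funM; last exact: mgam.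
  exact: measurable_reflect_kernel.
move=> t _; rewrite lee_fin mxE !normrM ler_wpM2l//.
apply: (le_trans (normr_coord_le_enorm _ _)); apply: le_trans (ler_norm _).
exact: enorm_selection_le gL1A (ggam t).
Qed.

Lemma sv_conv_selection D gam : conv_integrable g x D ->
  selection g gam -> sv_conv D g x (vintegral (fun t => D (x - t) *: gam t)).
Proof.
move=> DL sgam; exists (fun t => D (x - t) *: gam t) => //; split.
  exact: vintegrable_conv_selection.
by apply: aeW => t _; exists (gam t) => //; exact: sgam.1.
Qed.

(** An integrable selection [phi] of [t |-> D (x - t) g t] is
    [D (x - t) gam t] for the [gam] obtained by dividing where
    [D (x - t) != 0], completed by any measurable selection of [g] elsewhere
    and on the null set where [phi] leaves the prescribed values. *)
Lemma sv_convP D a : conv_integrable g x D -> sv_conv D g x a ->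
  exists2 gam, selection g gam & a = vintegral (fun t => D (x - t) *: gam t).
Proof.
move=> DL [phi [iphi [N [mN N0 phiN]]] <-]; have [mD iD] := DL.
have mI := @measurable_itv2pi R; have mDx := measurable_reflect_kernel x mD.
have [s [gs ms]] := L1A_selection gL1A.
have phig t : itv2pi R t -> ~ N t -> scaleset (D (x - t)) (g t) (phi t).
  by move=> It Nt; apply: contrapT => H; apply: Nt; apply: phiN => /(_ It).
pose A : set X := (itv2pi R `\` N) `&` [set t | D (x - t) != 0].
have mA : measurable A.
  apply: measurableI; first exact: measurableD.
  have -> : [set t | D (x - t) != 0] = (fun t : X => D (x - t)) @^-1` ~` [set 0].
    by apply/seteqP; split => t /=; [move=> /eqP|move=> /eqP].
  rewrite -[X in measurable X]setTI; apply: mDx => //.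
  by apply: measurableC; exact: measurable_set1.
pose gam (t : R) := if t \in A then (D (x - t))^-1 *: phi t else s t.
have sgam : selection g gam.
  split => [t|i].
    rewrite /gam; case: ifPn => [|_]; last exact: gs.
    rewrite inE => -[[It Nt] /= D0]; have [b gb <-] := phig t It Nt.
    by rewrite scalerA mulVf// scale1r.
  rewrite -(setUv A); apply/(measurable_funU _ mA (measurableC mA)); split.
    apply: (eq_measurable_fun (fun t : X => (D (x - t))^-1 * phi t 0 i)).
      by move=> t At; rewrite /gam At mxE.
    apply: measurable_funM.
      apply: (@measurable_comp _ _ _ X R R (~` [set 0]) (@GRing.inv R) A
               (fun t : X => D (x - t))).
      - by apply: measurableC; exact: measurable_set1.
      - by move=> _ [t [_ /= /eqP D0] <-].
      - apply: open_continuous_measurable_fun.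
          by apply: closed_openC; exact: closed_eq.
        by move=> y; rewrite inE => /eqP y0; exact: inv_continuous.
      - exact: measurable_funTS.
    have /measurable_int/measurable_EFinP := iphi i.
    by apply: measurable_funS => // t [[]].
  apply: (eq_measurable_fun (fun t : X => s t 0 i)).
    by move=> t; rewrite inE => At; rewrite /gam memNset.
  exact: measurable_funTS.
exists gam => //; apply/rowP => i; rewrite !mxE /Rintegral; congr fine.
apply: ae_eq_integral => //.
- exact: measurable_int (iphi i).
- exact: measurable_int (vintegrable_conv_selection DL sgam i).
- exists N; split => // t /= tH; apply: contrapT => Nt; apply: tH => It.
  congr EFin; rewrite mxE /gam; have [b gb bphi] := phig t It Nt.
  have [D0|D0] := eqVneq (D (x - t)) 0.
    by rewrite D0 mul0r -bphi D0 scale0r mxE.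
  by rewrite mem_set//= mxE mulrA mulfV// mul1r.
Qed.

Lemma sv_conv_kernel_close D1 D2 (r : R) a :
  conv_integrable g x D1 -> conv_integrable g x D2 ->
  (\int[lebmu R]_(t in itv2pi R)
    `|((D1 (x - t) - D2 (x - t))%R * gauge g t)%:E| <= r%:E)%E ->
  sv_conv D1 g x a -> exists2 b, sv_conv D2 g x b & enorm (a - b) <= r.
Proof.
move=> iD1 iD2 Dr /(sv_convP iD1)[gam sgam ->].
exists (vintegral (fun t => D2 (x - t) *: gam t)).
  exact: sv_conv_selection.
have iphi1 := vintegrable_conv_selection iD1 sgam.
have iphi2 := vintegrable_conv_selection iD2 sgam.
have [_ iD] := conv_integrableB iD1 iD2.
rewrite vintegralB//.
pose h t := `|(D1 (x - t) - D2 (x - t)) * gauge g t|.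
apply: (@le_trans _ _ (Rintegral (lebmu R) (itv2pi R) (h : X -> R))).
  apply: enorm_vintegral_le; first exact: vintegrableB.
    exact: (integrable_abse iD).
  move=> t It; rewrite -scalerBl enormZ /h normrM ler_wpM2l//.
  apply: le_trans (ler_norm _); exact: enorm_selection_le gL1A (sgam.1 t).
rewrite -lee_fin /Rintegral fineK; first exact: Dr.
exact: (integrable_fin_num (@measurable_itv2pi R) (integrable_abse iD)).
Qed.

End kernels.
End sv_convolution.

(** * One-sided approximation *)

Section trigonometric_polynomials.
Context {R : realType} {n : nat}.
Local Notation X := (lebesgueType R).

Lemma measurable_trigpoly (T : R -> R) :
  trigpoly n T -> measurable_fun [set: X] (T : X -> R).
Proof.
move=> [a0 [a [b TE]]].
have mT : measurable_fun [set: R] T.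
  have -> : T = (fun x => a0 / 2 + \sum_(1 <= k < n)
      (a k * cos (k%:R * x) + b k * sin (k%:R * x))) by apply/funext.
  have mkx (k : nat) : measurable_fun [set: R] (fun x : R => k%:R * x).
    exact: mulrl_measurable.
  apply: measurable_funD; first exact: measurable_cst.
  apply: measurable_sum => k; apply: measurable_funD; apply: measurable_funM;
    try exact: measurable_cst.
  - apply: (measurableT_comp _ (mkx k)); apply: continuous_measurable_fun.
    exact: continuous_cos.
  - apply: (measurableT_comp _ (mkx k)); apply: continuous_measurable_fun.
    exact: continuous_sin.
by move=> _ A mA; apply: borel_lebesgue_measurable; exact: mT.
Qed.

Lemma per2pi_trigpoly (T : R -> R) : trigpoly n T -> per2pi T.
Proof.
move=> [a0 [a [b TE]]] x; rewrite !TE; congr (_ + _); apply: eq_bigr => k _.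
have -> : k%:R * (x + 2 * pi) = k%:R * x + pi *+ 2 *+ k.
  by rewrite mulrDr !mulr_natl.
by rewrite (periodicn (@cosD2pi R)) (periodicn (@sinD2pi R)).
Qed.

End trigonometric_polynomials.

Local Open Scope ereal_scope.

Theorem theorem5 (R : realType) (m n : nat) (p q : \bar R) (K : R -> R)
    (m_ge1 : (1 <= m)%N) (n_ge1 : (1 <= n)%N)
    (p_ge1 : 1 <= p) (q_ge1 : 1 <= q) (pq1 : p^-1 + q^-1 = 1)
    (K_Lq : Lspace2pi q K) :
  one_sided +oo [set sv_conv K g | g in @Phi R m p] (@SVHtilde R m n)
    <= 2%:E * best_approx q K (trigpoly n).
Proof.
rewrite -lee_pdivrMl//; apply: le_ereal_inf_tmp => _ [T trigT <-].
rewrite lee_pdivrMl//; set e := normL q _.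
have e0 : 0 <= e by exact: Lnorm_ge0.
have [ey|ey] := eqVneq e +oo; first by rewrite ey mulry gtr0_sg// mul1e leey.
have efin : e \is a fin_num by rewrite ge0_fin_numE// ltey.
pose r := fine e.
have r0 : (0 <= r)%R by exact: fine_ge0.
have er : e = r%:E by rewrite fineK.
rewrite er; apply: ge_ereal_sup => _ [_ [g gPhi <-] <-].
have [mK pK _] := K_Lq.
have mT := measurable_trigpoly trigT.
have pT := per2pi_trigpoly trigT.
have gL := Phi_L1A gPhi.
have mD : measurable_fun [set: lebesgueType R]
    ((fun t => K t - T t)%R : lebesgueType R -> R) by exact: measurable_funB.
have pD : per2pi (fun t => K t - T t)%R by move=> t; rewrite pK pT.
have iK x : conv_integrable g x K.
  exact: (integrable_conv_gauge p_ge1 q_ge1 pq1 gPhi).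
have iD x : conv_integrable g x (fun t => K t - T t)%R.
  apply: (integrable_conv_gauge p_ge1 q_ge1 pq1 gPhi); split => //.
  by rewrite -/e ltey.
have iT x : conv_integrable g x T.
  have -> : T = (fun t => K t - (K t - T t))%R.
    by apply/funext => t; rewrite subKr.
  exact: conv_integrableB.
have KT x : \int[lebmu R]_(t in itv2pi R)
    `|((K (x - t) - T (x - t)) * gauge g t)%R%:E| <= r%:E.
  by rewrite -er; exact: (integral_conv_gauge_le p_ge1 q_ge1 pq1 gPhi x mD pD).
have TK x : \int[lebmu R]_(t in itv2pi R)
    `|((T (x - t) - K (x - t)) * gauge g t)%R%:E| <= r%:E.
  by under eq_integral do rewrite -opprB mulNr EFinN abseN.
have close x := hdist_addset_eball r0
  (fun a => sv_conv_kernel_close gL (iK x) (iT x) (KT x) (a := a))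
  (fun b => sv_conv_kernel_close gL (iT x) (iK x) (TK x) (a := b)).
pose tau x := addset (sv_conv T g x) (eball r).
apply: (@le_trans _ _ (distLA +oo (sv_conv K g) tau)).
  apply: ereal_inf_lbound; exists tau => //.
  split; last by move=> x; exact: (close x).1.
  exists (sv_conv T g); last by exists r.
  by exists T => //; exists g.
rewrite -EFinM; apply: normLy_le; first by rewrite mulr_ge0.
  move=> x; apply: hdist_ge0.
  have [gam sgam] := L1A_selection gL.
  exists (vintegral (fun t => K (x - t) *: gam t)%R).
  exact: sv_conv_selection.
by move=> x; exact: (close x).2.
Qed.
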